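(* Let $b$ be a prime and $s,m,n,\alpha\in\mathbb{N}$ with $\alpha\ge2$, $n\ge m$, and weights $\gamma_1,\dots,\gamma_s\ge0$. Let $p\in\mathbb{Z}_b[x]$ be irreducible with $\deg(p)=n$, and let $q_1,\dots,q_s\in R_{b,n}$ be chosen component by component: for $\tau=1,\dots,s$, given $\boldsymbol q_{\tau-1}=(q_1,\dots,q_{\tau-1})$, $q_\tau$ is a minimizer of $\tilde q\mapsto B_\alpha((\boldsymbol q_{\tau-1},\tilde q),p)$ over $\tilde q\in R_{b,n}$. Then for every $1\le\tau\le s$ and every $1/\alpha<\lambda\le1$, $$B_\alpha(\boldsymbol q_\tau,p)\le\frac{1}{b^{\min(m/\lambda,\,2n)}}\Big[-1+\prod_{j=1}^\tau\big(1+\gamma_j^{\lambda/2}D_{\alpha,b}^{\lambda/2}A_{\alpha,b,\lambda}\big)\Big]^{1/\lambda},$$ where $A_{\alpha,b,\lambda}=A_{\alpha,b,\lambda,1}+A_{\alpha,b,\lambda,2}$ with $$A_{\alpha,b,\lambda,1}=\frac{b}{b-1}\Big[\sum_{v=1}^{\alpha-1}\prod_{i=1}^v\frac{b-1}{b^{\lambda i}-1}+\frac{b^{\lambda\alpha}-1}{b^{\lambda\alpha}-b}\prod_{i=1}^\alpha\frac{b-1}{b^{\lambda i}-1}\Big],$$ $$A_{\alpha,b,\lambda,2}=\frac{1}{b-1}\sum_{v=2}^{\alpha-1}\prod_{i=1}^v\frac{b^\lambda(b-1)}{b^{\lambda i}-1}+\frac{b^\lambda}{b^{\lambda\alpha}-b}\prod_{i=1}^{\alpha-1}\frac{b^\lambda(b-1)}{b^{\lambda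 i}-1}.$$
   Context: $R_{b,n}=\{q\in\mathbb{Z}_b[x]:\deg(q)<n\}$. For $k\in\mathbb{N}_0$ with $b$-adic digits $\kappa_0,\kappa_1,\dots$, $\mathrm{tr}_n(k)(x)=\kappa_0+\kappa_1x+\dots+\kappa_{n-1}x^{n-1}$. For $\boldsymbol q_\tau=(q_1,\dots,q_\tau)\in(\mathbb{Z}_b[x])^\tau$, the dual polynomial lattice is $\mathcal{P}^\perp(\boldsymbol q_\tau,p)=\{\boldsymbol k\in\mathbb{N}_0^\tau:\mathrm{tr}_n(k_1)q_1+\dots+\mathrm{tr}_n(k_\tau)q_\tau\equiv a\pmod p$ for some $a\in\mathbb{Z}_b[x]$ with $\deg(a)<n-m\}$. Define $$B_\alpha(\boldsymbol q_\tau,p)=\sum_{\emptyset\ne u\subseteq\{1,\dots,\tau\}}\gamma_u^{1/2}D_{\alpha,b}^{|u|/2}\sum_{\substack{\boldsymbol k_u\in\mathcal{E}^{|u|}\\(\boldsymbol k_u,\boldsymbol0)\in\mathcal{P}^\perp(\boldsymbol q_\tau,p)}}b^{-\sum_{j\in u}\mu_\alpha(\lfloor k_j/b\rfloor)},$$ where $\gamma_u=\prod_{j\in u}\gamma_j$; $(\boldsymbol k_u,\boldsymbol 0)\in\mathbb{N}_0^\tau$ has entries $k_j$ for $j\in u$, $0$ otherwise; $\mathcal{E}=\{k\in\mathbb{N}:$ the $b$-adic digit sum of $k$ is $\equiv0\pmod b\}$; for $k\in\mathbb{N}$ written $k=\kappa_1b^{a_1-1}+\dots+\kappa_vb^{a_v-1}$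 with $0<\kappa_i<b$ and $a_1>\dots>a_v>0$, $\mu_\alpha(k)=a_1+\dots+a_{\min(v,\alpha)}$. $D_{\alpha,b}>0$ is a constant depending only on $\alpha,b$ such that $|\hat{\mathcal{K}}_{\alpha,(1)}(k,l)|\le D_{\alpha,b}b^{-\mu_\alpha(k)-\mu_\alpha(l)}$ for all $k,l\in\mathbb{N}$, where $\hat{\mathcal{K}}_{\alpha,(1)}$ are the $b$-adic Walsh coefficients of $\mathcal{K}_{\alpha,(1)}(x,y)=\sum_{\tau=1}^\alpha\frac{B_\tau(x)B_\tau(y)}{(\tau!)^2}+(-1)^{\alpha+1}\frac{B_{2\alpha}(|x-y|)}{(2\alpha)!}$ ($B_\tau$ Bernoulli polynomials). (The quantity $B_\alpha(\boldsymbol q,p)$ bounds the worst-case error in the weighted unanchored Sobolev space of order $\alpha$ of the QMC rule using the folded higher order polynomial lattice point set with modulus $p$ and generating vector $\boldsymbol q$.) *)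

(* Defs.v *)
From HB Require Import structures.
From mathcomp Require Import all_boot all_order all_algebra.
From mathcomp Require Import all_classical all_reals all_analysis.
Unset Printing Implicit Defensive.
Import Order.TTheory GRing.Theory Num.Theory.
Import numFieldNormedType.Exports.
Local Open Scope classical_set_scope.
Local Open Scope ring_scope.

Definition digit (b k i : nat) : nat := (k %/ b ^ i %% b)%N.

(* b-adic digit sum of k (for b >= 2, all digits of k have index < k) *)
Definition digitsum (b k : nat) : nat := (\sum_(i < k) digit b k i)%N.

Definition inE (b k : nat) : bool := (0 < k)%N && (digitsum b k %% b == 0)%N.

(* positions a of nonzero digits (k = sum kappa_i b^(a_i - 1)), decreasing *)
Definition nzpos (b k : nat) : seq nat :=
  [seq i.+1 | i <- rev (iota 0 k) & digit b k i != 0%N].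

Definition mu (alpha b k : nat) : nat := sumn (take alpha (nzpos b k)).

Definition trn (b n k : nat) : {poly 'F_b} := \poly_(i < n) ((digit b k i)%:R).

Definition in_dual (b n m : nat) (p : {poly 'F_b}) (qs : seq {poly 'F_b})
    (k : {ffun 'I_(size qs) -> nat}) : Prop :=
  exists a : {poly 'F_b}, (size a <= n - m)%N /\
    p %| (\sum_(j < size qs) trn b n (k j) * qs`_j - a).

(* B_alpha(q, p), where q = qs = (q_1,...,q_t) (0-based list), the weights are
   gamma_{j+1} = gamma j, and D stands for D_{alpha,b}.  Extended-real valued
   (the inner sums are series of nonnegative terms). *)
Definition Balpha {R : realType} (alpha b n m : nat) (gamma : nat -> R) (D : R)
    (p : {poly 'F_b}) (qs : seq {poly 'F_b}) : \bar R :=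
  (\sum_(u : {set 'I_(size qs)} | (0 < #|u|)%N)
     ((Num.sqrt (\prod_(j in u) gamma j) * Num.sqrt D ^+ #|u|)%:E *
      \esum_(k in [set k : {ffun 'I_(size qs) -> nat} |
                   (forall j, j \in u -> inE b (k j)) /\
                   (forall j, j \notin u -> k j = 0%N) /\
                   in_dual b n m p qs k])
        ((b%:R : R) ^- (\sum_(j in u) mu alpha b (k j %/ b))%N)%:E))%E.

Definition prim {R : fieldType} (p : {poly R}) : {poly R} :=
  \poly_(i < (size p).+1) (if i is i'.+1 then p`_i' / i%:R else 0).

(* Bernoulli polynomials: B_0 = 1, B_{n+1}' = (n+1) B_n, int_0^1 B_{n+1} = 0 *)
Fixpoint bernpoly (R : fieldType) (n : nat) : {poly R} :=
  if n is n'.+1 then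
    n%:R *: (prim (bernpoly R n') - ((prim (prim (bernpoly R n'))).[1])%:P)
  else 1.

Definition Kalpha {R : realType} (alpha : nat) (x y : R) : R :=
  \sum_(1 <= t < alpha.+1)
     (bernpoly R t).[x] * (bernpoly R t).[y] / ((t`!)%:R ^+ 2)
  + (-1) ^+ alpha.+1 * (bernpoly R (2 * alpha)).[`|x - y|] / ((2 * alpha)`!)%:R.

(* i-th b-adic digit xi_i (i >= 1) of x in [0,1): x = xi_1/b + xi_2/b^2 + ... *)
Definition xdigit {R : realType} (b : nat) (x : R) (i : nat) : nat :=
  `|(Num.floor (x * (b%:R) ^+ i) %% b%:Z)%Z|%N.

(* the b-adic Walsh function wal_k(x) = exp(2 pi i / b * walphase k x) *)
Definition walphase {R : realType} (b k : nat) (x : R) : nat :=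
  (\sum_(i < k) digit b k i * xdigit b x i.+1)%N.

(* real and imaginary parts of the Walsh coefficient
   hatK(k,l) = int_0^1 int_0^1 K(x,y) conj(wal_k(x)) wal_l(y) dx dy *)
Definition walsh_re {R : realType} (alpha b k l : nat) : R :=
  \int[@lebesgue_measure R]_(x in `[0%R, 1%R])
   \int[@lebesgue_measure R]_(y in `[0%R, 1%R])
     (Kalpha alpha x y *
      cos (2 * pi * ((walphase b l y)%:R - (walphase b k x)%:R) / b%:R)).

Definition walsh_im {R : realType} (alpha b k l : nat) : R :=
  \int[@lebesgue_measure R]_(x in `[0%R, 1%R])
   \int[@lebesgue_measure R]_(y in `[0%R, 1%R])
     (Kalpha alpha x y *
      sin (2 * pi * ((walphase b l y)%:R - (walphase b k x)%:R) / b%:R)).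

Definition admissibleD {R : realType} (alpha b : nat) (D : R) : Prop :=
  0 < D /\ forall k l : nat, (0 < k)%N -> (0 < l)%N ->
    Num.sqrt (walsh_re alpha b k l ^+ 2 + walsh_im alpha b k l ^+ 2)
      <= D * (b%:R) ^- (mu alpha b k + mu alpha b l).

Definition Aab1 {R : realType} (alpha b : nat) (lam : R) : R :=
  let bb := (b%:R : R) in
  bb / (bb - 1) *
  (\sum_(1 <= v < alpha) \prod_(1 <= i < v.+1) ((bb - 1) / (bb `^ (lam * i%:R) - 1))
   + (bb `^ (lam * alpha%:R) - 1) / (bb `^ (lam * alpha%:R) - bb) *
     \prod_(1 <= i < alpha.+1) ((bb - 1) / (bb `^ (lam * i%:R) - 1))).

Definition Aab2 {R : realType} (alpha b : nat) (lam : R) : R :=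
  let bb := (b%:R : R) in
  1 / (bb - 1) *
   \sum_(2 <= v < alpha)
      \prod_(1 <= i < v.+1) (bb `^ lam * (bb - 1) / (bb `^ (lam * i%:R) - 1))
  + bb `^ lam / (bb `^ (lam * alpha%:R) - bb) *
     \prod_(1 <= i < alpha) (bb `^ lam * (bb - 1) / (bb `^ (lam * i%:R) - 1)).

Definition Aab {R : realType} (alpha b : nat) (lam : R) : R :=
  Aab1 alpha b lam + Aab2 alpha b lam.

(* Main.v *)
Require Import Defs.
From HB Require Import structures.
From mathcomp Require Import all_boot all_order all_algebra.
From mathcomp Require Import all_classical all_reals all_analysis.
From mathcomp Require Import finmap ring lra zify.
Import Order.TTheory GRing.Theory Num.Theory.
Import numFieldNormedType.Exports.
Local Open Scope classical_set_scope.
Local Open Scope ring_scope.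

(** Write [1 + B_alpha(q_t)] as the sum, over all [k] in the dual lattice, of the
product weight [w_1(k_1) ... w_t(k_t)], where [w_j(0) = 1],
[w_j(k) = (gamma_j D)^(1/2) b^(-mu(k/b))] for [k] in [E], and [w_j(k) = 0] otherwise.
When a component [q'] is appended, the indices [k_(t+1)] with [tr_n(k_(t+1)) = 0]
contribute [(1 + B_alpha(q_t)) (1 + s)] with [s] independent of [q'].  For the other
indices [tr_n(k_(t+1))] is invertible modulo the irreducible [p], so that averaging the
[lam]-th powers (subadditivity of [y^lam]) over all [q'] gains a factor [b^-m], and some
[q'] is at least as good as the average.  Subadditivity applied to
[B_alpha(q_(t+1)) <= B_alpha(q_t) + s + B_alpha(q_t) s + theta] closes the induction.
It remains to bound [sum_(k in E) x^mu(k/b)] by [A_1], and its part over the multiples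
of [b^n] by [x^(2n) A_2], where [x = b^-lam]: both follow from the recursion satisfied
by the sums over [l < b^N] when the lowest digit is split off. *)

(** * Subadditivity of concave powers *)

(** With [s = x + y], each share [z / s] lies in [0, 1], so it is at most its own [l]-th power;
    multiply by [s ^ l] and add the shares of [x] and [y]. *)
Lemma powRD_le (R : realType) (x y l : R) : 0 <= x -> 0 <= y -> 0 < l <= 1 ->
  (x + y) `^ l <= x `^ l + y `^ l.
Proof.
move=> x0 y0 /andP[l0 l1].
have part z s : 0 <= z -> z <= s -> 0 < s -> z / s * s `^ l <= z `^ l.
  move=> z0 zs s0; have [->|zn0] := eqVneq z 0; first by rewrite !mul0r powR_ge0.
  have zp : 0 < z by rewrite lt_def zn0.
  rewrite -[in leRHS](divfK (lt0r_neq0 s0) z).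
  rewrite [leRHS]powRM ?(ltW s0) ?divr_ge0 ?(ltW s0)// ler_wpM2r ?powR_ge0//.
  by apply: ger1_powR => //; rewrite divr_gt0// ler_pdivrMr ?mul1r.
have [s0|s0] := ltP 0 (x + y); last first.
  have -> : x = 0 by lra.
  have -> : y = 0 by lra.
  by rewrite addr0 lerDl powR_ge0.
apply: le_trans (lerD (part x _ x0 _ s0) (part y _ y0 _ s0)); try lra.
by rewrite -mulrDl -mulrDl divff ?mul1r ?gt_eqF.
Qed.

Section esum_lemmas.
Context {R : realType} {T : choiceType}.
Local Open Scope ereal_scope.

Lemma esumZl (S : set T) (a : T -> \bar R) (r : R) : (0 <= r)%R ->
  (forall i, S i -> 0 <= a i) ->
  \esum_(i in S) (r%:E * a i) = r%:E * \esum_(i in S) a i.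
Proof.
move=> r0 a0; rewrite /esum -ereal_supZl//; last first.
  by apply/set0P; exists 0, set0; [exact: fsets_set0|rewrite fsbig_set0].
congr ereal_sup; rewrite image_comp; apply: eq_imagel => X [finX XS] /=.
rewrite !fsbig_finite//= big_seq [in RHS]big_seq ge0_sume_distrr//.
by move=> i; rewrite in_fset_set// => /set_mem /XS /a0.
Qed.

Lemma poweRD_le (x y : \bar R) (l : R) : 0 <= x -> 0 <= y -> (0 < l <= 1)%R ->
  (x + y) `^ l <= x `^ l + y `^ l.
Proof.
move=> x0 y0 l01; have l0 : l != 0%R by case/andP: l01 => /gt_eqF ->.
move: x y x0 y0 => [x| |] [y| |]// x0 y0.
- by rewrite -EFinD !poweR_EFin -EFinD lee_fin powRD_le.
- by rewrite addey// poweRyr// addey ?leey.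
- by rewrite addye// poweRyr// addye ?leey.
- by rewrite addye// poweRyr// addye ?leey.
Qed.

Lemma ge0_le_poweR (x y : \bar R) (l : R) : (0 <= l)%R -> 0 <= x -> x <= y ->
  x `^ l <= y `^ l.
Proof.
move=> l0 x0 xy; apply: gt0_ler_poweR => //; rewrite in_itv/= leey andbT//.
exact: le_trans xy.
Qed.

Lemma poweR_esum_le (S : set T) (a : T -> \bar R) (l : R) : (0 < l <= 1)%R ->
  (forall i, S i -> 0 <= a i) ->
  (\esum_(i in S) a i) `^ l <= \esum_(i in S) (a i `^ l).
Proof.
move=> l01 a0; have l0 : (0 < l)%R by case/andP: l01.
have nn i : S i -> 0 <= a i `^ l by move=> _; exact: poweR_ge0.
have fin (X : set T) : finite_set X -> X `<=` S ->
    (\sum_(i \in X) a i) `^ l <= \sum_(i \in X) (a i `^ l).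
  move=> finX XS; rewrite !fsbig_finite//=.
  have: forall i, i \in finmap.enum_fset (fset_set X) -> 0 <= a i.
    move=> i iX; have : i \in fset_set X by [].
    by rewrite in_fset_set// => /set_mem /XS /a0.
  elim: (finmap.enum_fset _) => [|i s IH] as0.
    by rewrite !big_nil poweR0r ?gt_eqF.
  rewrite !big_cons; have s0 : 0 <= \sum_(j <- s) a j.
    rewrite big_seq; apply: sume_ge0 => j js.
    by apply: as0; rewrite in_cons js orbT.
  apply: le_trans (poweRD_le _ _ _ _ _ l01) _ => //.
    by apply: as0; rewrite mem_head.
  apply: leeD => //; apply: IH => j js.
  by apply: as0; rewrite in_cons js orbT.
(* Taking the [l]-th root first leaves the sum of [a] alone on the left, a supremum that can be
   bounded one finite subset at a time. *)
have : \esum_(i in S) a i <= (\esum_(i in S) a i `^ l) `^ l^-1.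
  apply: ge_ereal_sup => _ [X [finX XS] <-].
  have sX0 : 0 <= \sum_(i \in X) a i by apply: fsume_ge0 => i /XS /a0.
  rewrite -[leLHS]poweRe1// -(mulfV (lt0r_neq0 l0)) poweRrM.
  apply: ge0_le_poweR; rewrite ?invr_ge0 ?(ltW l0) ?poweR_ge0//.
  by apply: le_trans (fin _ finX XS) _; apply: esum_ge; exists X.
move=> le1; rewrite -[leRHS]poweRe1 ?esum_ge0// -[1%R](mulVf (lt0r_neq0 l0)).
by rewrite poweRrM ge0_le_poweR ?(ltW l0) ?esum_ge0.
Qed.

End esum_lemmas.

(** * Weighted sums over the dual lattice *)

Section residues.
Context {R : realType} {F : finFieldType} (n : nat) (p : {poly F}).
Hypotheses (irr_p : irreducible_poly p) (size_p : size p = n.+1).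
Variable h : {poly F} -> \bar R.
Hypothesis h_mod : forall c, h (c %% p) = h c.

Let size_mod c : (size (c %% p)%R <= n)%N.
Proof. by rewrite -ltnS -size_p ltn_modp irredp_neq0. Qed.

(** Row vectors of length [n] represent the residues modulo [p], and translation by [c] permutes the
    residues. *)
Lemma sum_residues_shift c :
  (\sum_(v : 'rV[F]_n) h (rVpoly v + c) = \sum_(v : 'rV[F]_n) h (rVpoly v))%E.
Proof.
rewrite [RHS](reindex_inj (h := fun v => poly_rV ((rVpoly v + c) %% p))).
  by apply: eq_bigr => v _; rewrite poly_rV_K// h_mod.
move=> u v /(congr1 rVpoly); rewrite !poly_rV_K// !modpD => /addIr.
rewrite !modp_small ?size_p ?ltnS ?size_poly// => /(congr1 (@poly_rV _ n)).
by rewrite !rVpolyK.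
Qed.

(** Irreducibility makes [a] coprime to [p], so multiplication by [a] is injective on residues,
    hence a permutation of them. *)
Lemma sum_residues_mul a : ~~ (p %| a) ->
  (\sum_(v : 'rV[F]_n) h (a * rVpoly v) = \sum_(v : 'rV[F]_n) h (rVpoly v))%E.
Proof.
move=> pa; rewrite [RHS](reindex_inj (h := fun v => poly_rV ((a * rVpoly v) %% p))).
  by apply: eq_bigr => v _; rewrite poly_rV_K// h_mod.
have co : coprimep p a.
  rewrite coprimep_def; apply/eqP; have [_ irr] := irr_p.
  apply: contraNeq pa => gn1.
  have := irr _ gn1 (dvdp_gcdl p a); move/eqp_dvdl => <-.
  exact: dvdp_gcdr.
move=> u v /(congr1 rVpoly); rewrite !poly_rV_K// => /eqP.
rewrite -subr_eq0 -modpN -modpD -mulrBr => /eqP/modp_eq0P; rewrite Gauss_dvdpr//.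
move/modp_eq0P/eqP; rewrite modpD modpN subr_eq0 => /eqP.
rewrite !modp_small ?size_p ?ltnS ?size_poly// => /(congr1 (@poly_rV _ n)).
by rewrite !rVpolyK.
Qed.

End residues.

Section dualsum.
Context {R : realType} {F : finFieldType} (n d : nat) (p : {poly F}).
Variable tr : nat -> {poly F}.

(* With [t] components, the sum of [w 0 (k 0) * ... * w t.-1 (k t.-1)] over the [k]
   such that [c + \sum_j tr (k j) * q j] has a remainder of size at most [d] modulo [p]
   (see [dualsumE]). The shift [c] makes the sum recursive in [t]. *)
Fixpoint dualsum (w : nat -> nat -> R) (q : nat -> {poly F}) (t : nat)
    (c : {poly F}) : \bar R :=
  if t is t'.+1 then
    \esum_(k in setT) ((w t' k)%:E * dualsum w q t' (c + tr k * q t'))%E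
  else ((size (c %% p)%R <= d)%N%:R)%:E.

Implicit Types (w : nat -> nat -> R) (q : nat -> {poly F}).
Local Open Scope ereal_scope.

Lemma dualsum_ge0 w q t c : (forall j k, (0 <= w j k)%R) ->
  0 <= dualsum w q t c.
Proof.
move=> w0; elim: t c => [|t IH] c /=; first by rewrite lee_fin ler0n.
by apply: esum_ge0 => k _; rewrite mule_ge0 ?lee_fin ?w0.
Qed.

Lemma eq_dualsum w q q' t c : (forall j, (j < t)%N -> q j = q' j) ->
  dualsum w q t c = dualsum w q' t c.
Proof.
elim: t c => [//|t IH] c qq' /=; apply: eq_esum => k _.
by rewrite qq'// IH// => j jt; apply: qq'; rewrite ltnS ltnW.
Qed.

Lemma dualsum_modp w q t c : dualsum w q t (c %% p)%R = dualsum w q t c.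
Proof.
suff gen c1 c2 : (c1 %% p = c2 %% p)%R -> dualsum w q t c1 = dualsum w q t c2.
  by apply: gen; rewrite modp_id.
elim: t c1 c2 => [|t IH] c1 c2 /= e; first by rewrite e.
by apply: eq_esum => k _; congr (_ * _); apply: IH; rewrite !modpD e.
Qed.

(** Subadditivity is applied once per component; at the base the indicator is 0 or 1, which the
    power leaves unchanged. *)
Lemma poweR_dualsum_le w q t c l : (0 < l <= 1)%R ->
  (forall j k, (0 <= w j k)%R) ->
  dualsum w q t c `^ l <= dualsum (fun j k => w j k `^ l)%R q t c.
Proof.
move=> l01 w0; elim: t c => [|t IH] c /=.
  case: (_ <= _)%N => /=; rewrite ?powR1// powR0//.
  by case/andP: l01 => /gt_eqF ->.
apply: (le_trans (poweR_esum_le _ _ _ l01 _)) => [k _|].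
  by rewrite mule_ge0 ?lee_fin ?w0 ?dualsum_ge0.
apply: le_esum => k _; rewrite poweRM ?lee_fin ?dualsum_ge0// poweR_EFin.
by apply: lee_wpmul2l; rewrite ?lee_fin ?powR_ge0.
Qed.

Hypotheses (irr_p : irreducible_poly p) (size_p : size p = n.+1).

(** Summing over all shifts decouples the components by translation invariance, and each contributes
    its own factor [s j]. The factor [#|F| ^ d] bounds the number of residues of size at most
    [d]. *)
Lemma sum_dualsum_le w q t (s : nat -> R) : (forall j k, (0 <= w j k)%R) ->
  (forall j, (j < t)%N -> \esum_(k in setT) (w j k)%:E <= (s j)%:E) ->
  \sum_(v : 'rV[F]_n) dualsum w q t (rVpoly v) <=
    ((#|F| ^ d)%:R * \prod_(j < t) s j)%:E.
Proof.
move=> w0; elim: t => [|t IH] ws.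
  rewrite big_ord0 mulr1 /= sumEFin lee_fin -natr_sum ler_nat.
  under eq_bigr => v _ do
    rewrite modp_small ?size_p ?ltnS ?size_poly//.
  rewrite -big_mkcond/= sum1dep_card -[X in (_ <= #|_| ^ X)%N]mul1n -card_mx.
  set A := (X in (#|X| <= _)%N).
  (* Truncation to [d] coefficients is injective on polynomials of size at most [d]. *)
  rewrite -(card_in_imset (f := fun v => poly_rV (rVpoly v) : 'rV[F]_d) (D := A)).
    exact: max_card.
  move=> u v; rewrite !finset.inE => ud vd /(congr1 rVpoly).
  by rewrite !poly_rV_K// => /(congr1 (@poly_rV _ n)); rewrite !rVpolyK.
have s0 j : (j < t.+1)%N -> (0 <= s j)%R.
  move=> jt; rewrite -lee_fin; apply: le_trans (ws _ jt).
  by apply: esum_ge0 => k _; rewrite lee_fin w0.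
rewrite /= -esum_sum => [|k v _ _]; last by rewrite mule_ge0 ?lee_fin ?w0 ?dualsum_ge0.
pose C := ((#|F| ^ d)%:R * \prod_(j < t) s j)%R.
have C0 : (0 <= C)%R by rewrite mulr_ge0// prodr_ge0// => j _; apply: s0; rewrite ltnS ltnW.
apply: (@le_trans _ _ (\esum_(k in setT) (C%:E * (w t k)%:E))).
  apply: le_esum => k _; rewrite -ge0_sume_distrr; last by move=> v _; exact: dualsum_ge0.
  rewrite muleC; apply: lee_wpmul2r; first by rewrite lee_fin.
  rewrite (sum_residues_shift _ _ irr_p size_p) => [|c]; last exact: dualsum_modp.
  by apply: IH => j jt; apply: ws; rewrite ltnS ltnW.
rewrite esumZl// => [|k _]; last by rewrite lee_fin.
rewrite big_ord_recr/= mulrA -/C [leRHS]EFinM; apply: lee_wpmul2l; first by rewrite lee_fin.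
exact: ws.
Qed.

End dualsum.

(** Induction on [t]: pairing the last index with the vector of the others ([ext]) turns the
    iterated sum into a single one. *)
Lemma dualsumE (R : realType) (F : finFieldType) (d : nat) (p : {poly F})
    (tr : nat -> {poly F}) (w : nat -> nat -> R) (q : nat -> {poly F}) t c :
  (forall j k, 0 <= w j k) ->
  dualsum d p tr w q t c =
  \esum_(f in [set: {ffun 'I_t -> nat}])
    (\prod_(j < t) w j (f j) *
     (size ((c + \sum_(j < t) tr (f j) * q j) %% p)%R <= d)%N%:R)%:E.
Proof.
move=> w0; elim: t c => [|t IH] c.
  have -> : [set: {ffun 'I_0 -> nat}] = [set [ffun=> 0%N]].
    by apply/seteqP; split=> // f _; apply/ffunP => -[].
  rewrite esum_set1; last by rewrite big_ord0 mul1r lee_fin ler0n.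
  by rewrite !big_ord0 mul1r addr0.
pose ext (kf : nat * {ffun 'I_t -> nat}) : {ffun 'I_t.+1 -> nat} :=
  [ffun j : 'I_t.+1 => if insub (j : nat) is Some i then kf.2 i else kf.1].
have extl kf i : ext kf (widen_ord (leqnSn t) i) = kf.2 i.
  by rewrite ffunE (_ : insub _ = Some i)//; exact: valK.
have extr kf : ext kf ord_max = kf.1 by rewrite ffunE insubF//= ltnn.
have bij_ext : set_bij ([set: nat] `*`` (fun=> [set: {ffun 'I_t -> nat}])) setT ext.
  split=> //.
  - move=> [k f] [k' f'] _ _ e; congr pair.
      by have := congr1 (fun g : {ffun _} => g ord_max) e; rewrite !extr.
    apply/ffunP => i.
    by have := congr1 (fun g : {ffun _} => g (widen_ord (leqnSn t) i)) e; rewrite !extl.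
  - move=> g _; exists (g ord_max, [ffun i => g (widen_ord (leqnSn t) i)]) => //.
    apply/ffunP => j; have [i ->|->] := unliftP ord_max j.
      have -> : lift ord_max i = widen_ord (leqnSn t) i by apply/val_inj/lift_max.
      by rewrite extl ffunE.
    by rewrite extr.
pose G k f := (\prod_(j < t.+1) w j (ext (k, f) j) *
    (size ((c + \sum_(j < t.+1) tr (ext (k, f) j) * q j) %% p)%R <= d)%N%:R)%:E.
rewrite (reindex_esum _ _ _ _ bij_ext).
transitivity (\esum_(kf in [set: nat] `*`` (fun=> [set: {ffun 'I_t -> nat}])) G kf.1 kf.2);
  last by apply: eq_esum => -[].
rewrite -esum_esum /G.
  rewrite [LHS]/=; apply: eq_esum => k _; rewrite IH -esumZl => //; last first.
    by move=> f _; rewrite lee_fin mulr_ge0// prodr_ge0.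
  apply: eq_esum => f _; rewrite !big_ord_recr/= extr -EFinM mulrA (mulrC (w t k)).
  rewrite -addrA (addrC (tr k * q t)).
  under [in RHS]eq_bigr do rewrite extl.
  by under [in X in _ = (_ * (size ((_ + (X + _)) %% _)%R <= _)%N%:R)%:E]eq_bigr
    do rewrite extl.
by move=> k f _ _; rewrite lee_fin mulr_ge0// prodr_ge0.
Qed.

(** The value 1 at [k = 0] is neutral in products, so one sum over all index vectors covers every
    support [u]; [g j] stands for [(gamma_j D)^(1/2)]. *)
Definition cweight {R : realType} (alpha b : nat) (g : nat -> R) (j k : nat) : R :=
  if k == 0%N then 1
  else if Defs.inE b k then g j * b%:R ^- mu alpha b (k %/ b) else 0.

Lemma cweight_ge0 {R : realType} alpha b (g : nat -> R) j k :
  0 <= g j -> 0 <= cweight alpha b g j k.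
Proof.
by move=> g0; rewrite /cweight; case: ifP => // _; case: ifP => // _; rewrite divr_ge0.
Qed.

(** A polynomial [a] with [size a <= n - m] is its own remainder modulo [p]. *)
Lemma in_dualE (b n m : nat) (p : {poly 'F_b}) qs k :
  size p = n.+1 ->
  in_dual b n m p qs k <->
  (size ((\sum_(j < size qs) trn b n (k j) * qs`_j) %% p)%R <= n - m)%N.
Proof.
move=> size_p; split=> [[a [sa]]|sk]; last first.
  exists ((\sum_(j < size qs) trn b n (k j) * qs`_j) %% p); split=> //.
  by apply/modp_eq0P; rewrite modpD modpN modp_id subrr.
move/modp_eq0P/eqP; rewrite modpD modpN subr_eq0 => /eqP ->.
by rewrite modp_small// size_p ltnS (leq_trans sa)// leq_subr.
Qed.

(** The set [u] is recovered from [k] as its support, because E excludes 0. The double sum over [u]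
    and [k] is therefore one sum over all [k], the leading 1 being the term of the empty set. *)
Lemma Balpha_dualsum (R : realType) (alpha b n m : nat) (gamma : nat -> R) (D : R)
    (p : {poly 'F_b}) (qs : seq {poly 'F_b}) :
  (forall j, (j < size qs)%N -> 0 <= gamma j) -> size p = n.+1 ->
  (1 + Balpha alpha b n m gamma D p qs)%E =
  dualsum (n - m) p (trn b n)
    (cweight alpha b (fun j => Num.sqrt (gamma j) * Num.sqrt D))
    (nth 0 qs) (size qs) 0.
Proof.
move=> gamma0 size_p; set w := cweight _ _ _.
have w0 j k : 0 <= w j k by apply: cweight_ge0; rewrite mulr_ge0 ?sqrtr_ge0.
pose S (u : {set 'I_(size qs)}) := [set k : {ffun 'I_(size qs) -> nat} |
                   (forall j, j \in u -> Defs.inE b (k j)) /\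
                   (forall j, j \notin u -> k j = 0%N) /\
                   in_dual b n m p qs k].
pose c (u : {set 'I_(size qs)}) : R :=
  Num.sqrt (\prod_(j in u) gamma j) * Num.sqrt D ^+ #|u|.
pose e (u : {set 'I_(size qs)}) (k : {ffun 'I_(size qs) -> nat}) : R :=
  (b%:R : R) ^- (\sum_(j in u) mu alpha b (k j %/ b))%N.
have c0 u : 0 <= c u by rewrite mulr_ge0 ?exprn_ge0 ?sqrtr_ge0.
have e0 u k : 0 <= e u k by rewrite invr_ge0 exprn_ge0.
have supp_unique u k : S u k -> u = [set j | k j != 0%N]%SET.
  move=> [ku [k0 _]]; apply/setP => j; rewrite finset.inE.
  have [ju|ju] := boolP (j \in u); last by rewrite (k0 j ju) eqxx.
  by have /andP[kj _] := ku j ju; rewrite -lt0n kj.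
have -> : (1 + Balpha alpha b n m gamma D p qs =
    \sum_(u : {set 'I_(size qs)}) ((c u)%:E * \esum_(k in S u) (e u k)%:E))%E.
  rewrite (bigD1 finset.set0)//=; congr (_ + _)%E; last first.
    by apply: eq_bigl => u; rewrite card_gt0.
  have -> : S finset.set0 = [set [ffun=> 0%N]].
    apply/seteqP; split=> k /=.
      by move=> [_ [k0 _]]; apply/ffunP => j; rewrite ffunE k0 ?finset.inE.
    move=> ->; split; first by move=> j; rewrite finset.inE.
    split; first by move=> j _; rewrite ffunE.
    apply/in_dualE => //; rewrite big1 ?mod0p ?size_poly0// => j _.
    rewrite ffunE (_ : trn b n 0 = 0) ?mul0r//; apply/polyP => i.
    by rewrite coef_poly /digit div0n mod0n coef0; case: ifP.
  rewrite esum_set1 ?lee_fin// /c /e !big_set0 cards0 sqrtr1 expr0 invr1.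
  by rewrite -EFinM !mulr1.
under eq_bigr => u _.
  rewrite -(esumZl _ _ _ (c0 u)); last by move=> k _; rewrite lee_fin.
  rewrite esum_mkcond; over.
rewrite -esum_sum; last first.
  by move=> k u _ _; case: ifP => // _; rewrite mule_ge0// lee_fin.
rewrite dualsumE//; apply: eq_esum => k _.
set u := [set j | k j != 0%N]%SET.
rewrite (bigD1 u)//= big1 ?adde0; last first.
  by move=> v vu; case: ifPn => // /set_mem /supp_unique vE; rewrite vE eqxx in vu.
rewrite add0r; case: ifPn => [/set_mem|/negP nS].
  move=> [kE [k0 /(in_dualE _ _ _ _ _ _ size_p) ->]]; rewrite mulr1 -EFinM; congr EFin.
  rewrite [RHS](bigID (mem u))/= [X in _ = _ * X]big1 ?mulr1; last first.
    by move=> j ju; rewrite /w /cweight k0 ?eqxx.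
  rewrite /c /e; have -> : Num.sqrt (\prod_(j in u) gamma j) =
      \prod_(j in u) Num.sqrt (gamma j).
    have : 0 <= \prod_(j in u) gamma j /\
        Num.sqrt (\prod_(j in u) gamma j) = \prod_(j in u) Num.sqrt (gamma j).
      elim/big_rec2: _ => [|j x y _ [y0 <-]]; first by rewrite sqrtr1.
      by rewrite mulr_ge0 ?gamma0// sqrtrM ?gamma0.
    by case.
  rewrite -prodr_const -big_split/= expr_sum -prodfV -big_split/=.
  apply: eq_bigr => j ju; rewrite /w /cweight kE//.
  by move: ju; rewrite finset.inE => /negbTE ->.
(* Here [k] fails [S u]: either some component outside E has weight 0, or [k] is off the dual
   lattice and the indicator is 0. *)
have [/forallP kE|/forallPn[j]] := boolP [forall j, (j \in u) ==> Defs.inE b (k j)]; last first.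
  rewrite negb_imply => /andP[ju nE]; rewrite (bigD1 j)//= /w /cweight (negbTE nE).
  by move: ju; rewrite finset.inE => /negbTE ->; rewrite !mul0r.
have [kd|] := boolP (size _ <= n - m)%N; last by rewrite mulr0.
case: nS; apply/mem_set; split=> [j ju|]; first by have := kE j; rewrite ju.
split; last exact/in_dualE.
by move=> j; rewrite finset.inE negbK => /eqP.
Qed.

(** * Digits in base b *)

Section digits.
Variable b : nat.
Hypothesis b_gt1 : (1 < b)%N.
Local Open Scope nat_scope.

Lemma digit_blockS l r i : r < b -> digit b (b * l + r) i.+1 = digit b l i.
Proof.
move=> rb; rewrite /digit expnS divnMA mulnC divnMDl ?(ltnW b_gt1)//.
by rewrite (divn_small rb) addn0.
Qed.

Lemma digit_block0 l r : r < b -> digit b (b * l + r) 0 = r.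
Proof. by move=> rb; rewrite /digit expn0 divn1 mulnC modnMDl modn_small. Qed.

Lemma digit_small k i : k <= i -> digit b k i = 0.
Proof.
by move=> ki; rewrite /digit divn_small ?mod0n// (leq_ltn_trans ki)// ltn_expl.
Qed.

Let block_le l r : b * l + r <= (b * l + r).+1 /\ l <= b * l + r.
Proof. by split=> //; nia. Qed.

Lemma digitsum_block l r : r < b -> digitsum b (b * l + r) = digitsum b l + r.
Proof.
move=> rb; have widen k N : k <= N -> digitsum b k = \sum_(0 <= i < N) digit b k i.
  move=> kN; rewrite (@big_cat_nat _ _ _ k)//= [X in _ + X]big1_seq ?addn0.
    by rewrite /digitsum big_mkord.
  by move=> i; rewrite mem_index_iota => /andP[_ /andP[ki _]]; exact: digit_small.
(* The range for [b * l + r] is taken one longer than that for [l], so that removing index 0 leaves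
   the same indices shifted by one. *)
rewrite (widen _ _ (block_le l r).1) (widen _ _ (block_le l r).2).
rewrite big_nat_recl//= digit_block0// addnC; congr (_ + _).
by apply: eq_bigr => i _; rewrite digit_blockS.
Qed.

Lemma nzpos_block l r : r < b ->
  nzpos b (b * l + r) = [seq i.+1 | i <- nzpos b l] ++ nseq (r != 0) 1.
Proof.
move=> rb; have widen k N : k <= N ->
    nzpos b k = [seq i.+1 | i <- rev (iota 0 N) & digit b k i != 0].
  move=> kN; rewrite -(subnKC kN) iotaD rev_cat filter_cat map_cat add0n.
  rewrite [X in X ++ _](_ : _ = [::])//; apply/eqP; rewrite -size_eq0 size_map size_filter.
  rewrite -leqn0 leqNgt -has_count; apply/hasPn => i; rewrite mem_rev mem_iota => /andP[ki _].
  by rewrite digit_small.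
rewrite (widen _ _ (block_le l r).1) (widen _ _ (block_le l r).2).
rewrite -[(b * l + r).+1]add1n iotaD rev_cat filter_cat map_cat.
congr (_ ++ _); last by rewrite /= digit_block0//; case: (r != 0).
rewrite add0n -[1]addn0 iotaDl -map_rev filter_map -!map_comp.
congr map; apply: eq_filter => i /=; by rewrite add1n digit_blockS.
Qed.

Definition nnz k := size (nzpos b k).

Lemma nnz_block l r : r < b -> nnz (b * l + r) = nnz l + (r != 0).
Proof. by move=> rb; rewrite /nnz nzpos_block// size_cat size_map size_nseq. Qed.

(** A new lowest digit raises each counted position by one; if nonzero it sits at position 1, which
    counts only when fewer than [alpha] positions precede it. *)
Lemma mu_block alpha l r : r < b ->
  mu alpha b (b * l + r) =
    mu alpha b l + minn alpha (nnz l) + ((r != 0) && (nnz l < alpha)).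
Proof.
move=> rb; have sumnS s : sumn [seq i.+1 | i <- s] = sumn s + size s.
  by elim: s => //= i s ->; lia.
rewrite /mu nzpos_block// take_cat size_map -/(nnz l); case: ltnP => ll.
  rewrite -map_take sumnS size_take -/(nnz l) ll.
  by rewrite ltnNge (ltnW ll) andbF addn0.
rewrite sumn_cat sumnS -/(nnz l) (take_oversize ll); congr (_ + _).
by rewrite -subn_gt0; case: (r != 0); case: (alpha - nnz l).
Qed.

Lemma nnz_gt0 k : 0 < k -> 0 < nnz k.
Proof.
elim/ltn_ind: k => k IH k0; rewrite (divn_eq k b) mulnC nnz_block ?ltn_mod ?(ltnW b_gt1)//.
have [r0|] := eqVneq (k %% b) 0; last by rewrite addn1.
rewrite addn0 IH ?ltn_Pdiv//.
by move: k0; rewrite {1}(divn_eq k b) r0 addn0; case: (k %/ b).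
Qed.

Lemma inE_block l r : r < b ->
  Defs.inE b (b * l + r) = (0 < l) && ((digitsum b l + r) %% b == 0).
Proof.
move=> rb; rewrite /Defs.inE digitsum_block//.
have [->|l0] := posnP l; last by rewrite addn_gt0 muln_gt0 l0 (ltnW b_gt1).
rewrite muln0 add0n /= {1}/digitsum big_ord0 add0n modn_small//.
by case: r rb.
Qed.

(** Strip trailing zeros. The lowest nonzero digit alone is below [b], so the quotient is positive
    and holds a second nonzero digit. *)
Lemma inE_nnz k : Defs.inE b k -> 2 <= nnz k.
Proof.
elim/ltn_ind: k => k IH; have rb : k %% b < b by rewrite ltn_mod (ltnW b_gt1).
rewrite (divn_eq k b) mulnC inE_block// nnz_block// => /andP[l0 ds].
have [r0|] := eqVneq (k %% b) 0; last by rewrite addn1 ltnS nnz_gt0.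
rewrite addn0 IH ?/Defs.inE ?l0//=; last by move: ds; rewrite r0 addn0.
by rewrite ltn_Pdiv//; move: l0; case: k {IH rb r0 ds} => //; rewrite div0n.
Qed.

Lemma inE_shift j k : Defs.inE b (b ^ j * k) = Defs.inE b k.
Proof.
elim: j => [|j IH]; first by rewrite mul1n.
rewrite expnS -mulnA -[b * _]addn0 inE_block ?(ltnW b_gt1)// addn0 -IH.
by [].
Qed.

Lemma nnz_shift j k : nnz (b ^ j * k) = nnz k.
Proof.
elim: j => [|j IH]; first by rewrite mul1n.
by rewrite expnS -mulnA -[b * _]addn0 nnz_block ?(ltnW b_gt1)// addn0.
Qed.

Lemma mu_shift alpha j k :
  mu alpha b (b ^ j * k) = mu alpha b k + j * minn alpha (nnz k).
Proof.
elim: j => [|j IH]; first by rewrite mul1n addn0.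
rewrite expnS -mulnA -[b * _]addn0 mu_block ?(ltnW b_gt1)// nnz_shift IH /=; lia.
Qed.

End digits.

(** Serves with [b] to split off the lowest digit, and with [b ^ n] to split off the lowest [n]
    digits together. *)
Lemma sum_nat_block (V : nmodType) (b M : nat) (F : nat -> V) :
  \sum_(0 <= k < b * M) F k = \sum_(0 <= l < M) \sum_(0 <= r < b) F (b * l + r)%N.
Proof.
elim: M => [|M IH]; first by rewrite muln0 !big_geq.
rewrite big_nat_recr//= -IH mulnS addnC (@big_cat_nat _ _ _ (b * M))//=; last exact: leq_addr.
congr (_ + _); rewrite -{1}[(b * M)%N]add0n big_addn addKn.
by apply: eq_bigr => r _; rewrite addnC.
Qed.

(** * Sums of x^mu(l) by the number of nonzero digits of l *)

Section digit_series.
Context {R : realType}.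
Variables (b alpha : nat) (x : R).
Hypotheses (b_gt1 : (1 < b)%N) (alpha_gt1 : (1 < alpha)%N).
Hypotheses (x_gt0 : 0 < x) (x_lt1 : x < 1) (bx_lt1 : b%:R * x ^+ alpha < 1).

Let B : R := b%:R.
Let B_gt1 : 1 < B. Proof. by rewrite ltr1n. Qed.
Let X v : 0 < x ^+ v. Proof. exact: exprn_gt0. Qed.
Let X1 v : x ^+ v.+1 < 1.
Proof. by rewrite exprn_ilt1 ?ltW. Qed.

(* The sum of [x ^+ mu alpha b l] over all [l] with exactly [v < alpha] nonzero digits.
   It is the fixed point [sigma_fix] of the recursion that splits off the lowest digit,
   hence bounds all the partial sums over [l < b ^ N]. *)
Definition sigma v : R := \prod_(1 <= i < v.+1) ((B - 1) / (x ^- i - 1)).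

Lemma sigma0 : sigma 0 = 1. Proof. by rewrite /sigma big_geq. Qed.

Lemma sigmaS v : sigma v.+1 = sigma v * ((B - 1) / (x ^- v.+1 - 1)).
Proof. by rewrite /sigma big_nat_recr. Qed.

Lemma sigma_gt0 v : 0 < sigma v.
Proof.
elim: v => [|v IH]; first by rewrite sigma0.
rewrite sigmaS mulr_gt0// divr_gt0 ?subr_gt0// invf_gt1//.
Qed.

(** The first term accounts for a lowest digit 0, the second for the [b - 1] nonzero digits appended
    to numbers with [v] nonzero digits; in both cases [mu] grows by [v + 1]. *)
Lemma sigma_fix v :
  x ^+ v.+1 * sigma v.+1 + (B - 1) * x ^+ v.+1 * sigma v = sigma v.+1.
Proof.
rewrite sigmaS; have := X1 v; have := X v.+1; move: (x ^+ v.+1) => y y0 y1.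
by field; apply/andP; split; lra.
Qed.

(* [(B - 1) * tailsum] is the sum over all [l] with at least [alpha] nonzero digits. *)
Definition tailsum : R := sigma alpha.-1 / (x ^- alpha - B).

Lemma tail_den_gt0 : 0 < x ^- alpha - B.
Proof. by rewrite subr_gt0 -[_^-1]mul1r ltr_pdivlMr. Qed.

Lemma tailsum_ge0 : 0 <= tailsum.
Proof. by rewrite divr_ge0 ?ltW ?sigma_gt0 ?tail_den_gt0. Qed.

(** Once [alpha] nonzero digits are present, each of the [b] lowest digits costs [x ^ alpha]; the
    second term enters from exactly [alpha - 1] nonzero digits. *)
Lemma tailsum_fix :
  B * x ^+ alpha * ((B - 1) * tailsum) + (B - 1) * x ^+ alpha * sigma alpha.-1 =
  (B - 1) * tailsum.
Proof.
rewrite /tailsum; have := bx_lt1; have := X alpha; rewrite -/B.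
move: (x ^+ alpha) (sigma _) => y s y0 y1; field; apply/andP; split; lra.
Qed.

(** Counterpart of [tailsum_fix] with a single admissible lowest digit; the left side equals
    [(1 - x ^ alpha) * tailsum]. *)
Lemma tailsum_res :
  x ^+ alpha * ((B - 1) * tailsum + sigma alpha.-1) <= tailsum.
Proof.
have -> : x ^+ alpha * ((B - 1) * tailsum + sigma alpha.-1) =
   (1 - x ^+ alpha) * tailsum.
  rewrite /tailsum; have := bx_lt1; have := X alpha; rewrite -/B.
  move: (x ^+ alpha) (sigma _) => y s y0 y1; field; apply/andP; split; lra.
by rewrite ler_piMl ?tailsum_ge0// gerBl ltW.
Qed.

Let wt l : R := x ^+ mu alpha b l.
Let wt_ge0 l : 0 <= wt l. Proof. exact/ltW/X. Qed.
Local Notation nz := (nnz b).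

Let wt_block l r : (r < b)%N ->
  wt (b * l + r)%N = wt l * x ^+ (minn alpha (nz l) + ((r != 0%N) && (nz l < alpha)%N)).
Proof. by move=> rb; rewrite /wt mu_block// -addnA exprD. Qed.

Lemma sum_digit0 (F : nat -> R) :
  \sum_(0 <= r < b) F r = F 0%N + \sum_(1 <= r < b) F r.
Proof. by rewrite big_ltn// (ltnW b_gt1). Qed.

Lemma sum_nnz_eq_le N v : (v < alpha)%N ->
  \sum_(0 <= l < b ^ N) (nz l == v)%:R * wt l <= sigma v.
Proof.
elim: N v => [|N IH] v va.
  rewrite expn0 big_nat1 /nnz /nzpos /wt /mu /= expr0 mulr1.
  by case: v {va} => [|v] /=; rewrite ?sigma0// ltW ?sigma_gt0.
rewrite expnS sum_nat_block.
have -> : \sum_(0 <= l < b ^ N) \sum_(0 <= r < b)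
      (nz (b * l + r) == v)%:R * wt (b * l + r)%N =
    x ^+ v * \sum_(0 <= l < b ^ N) (nz l == v)%:R * wt l +
    (B - 1) * x ^+ v * \sum_(0 <= l < b ^ N) ((nz l).+1 == v)%:R * wt l.
  rewrite !mulr_sumr -big_split/=; apply: eq_bigr => l _.
  rewrite sum_digit0 wt_block ?(ltnW b_gt1)// nnz_block ?(ltnW b_gt1)//= !addn0.
  congr (_ + _).
    case: eqP => [->|_]; last by rewrite !mul0r mulr0.
    by rewrite (minn_idPr (ltnW va)); ring.
  have -> : (B - 1) * x ^+ v * (((nz l).+1 == v)%:R * wt l) =
      \sum_(1 <= r < b) ((nz l).+1 == v)%:R * wt l * x ^+ v.
    rewrite sumr_const_nat -[RHS]mulr_natr natrB ?(ltnW b_gt1)//; ring.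
  rewrite big_nat [RHS]big_nat; apply: eq_bigr => r /andP[r0 rb].
  rewrite wt_block// nnz_block// (_ : (r != 0%N)) ?lt0n_neq0//= addn1.
  case: eqP => [e|_]; last by rewrite !mul0r.
  rewrite -e in va *; rewrite (minn_idPr (ltnW (ltnW va))) (ltnW va) addn1; ring.
case: v va => [|v] va.
  rewrite expr0 mul1r [X in _ + _ * X]big1 ?mulr0 ?addr0; last by move=> l _; rewrite mul0r.
  exact: IH.
rewrite -[leRHS]sigma_fix; apply: lerD; first by rewrite ler_wpM2l ?IH ?(ltW (X _)).
rewrite ler_wpM2l ?mulr_ge0 ?subr_ge0 ?(ltW (X _)) ?(ltW B_gt1)//.
under eq_bigr do rewrite eqSS.
exact/IH/ltnW.
Qed.

(** There are two ways to reach [alpha] nonzero digits: [l] has them already, or it has [alpha - 1]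
    and [r] is nonzero. In both, [mu] grows by exactly [alpha]. *)
Let tail_block l r : (r < b)%N ->
  (alpha <= nz (b * l + r))%N%:R * wt (b * l + r)%N =
  ((alpha <= nz l)%N%:R + ((r != 0%N) && (nz l == alpha.-1))%:R) * wt l * x ^+ alpha.
Proof.
move=> rb.
rewrite wt_block// nnz_block//.
case: (ltngtP (nz l) alpha.-1) => h.
- rewrite (_ : (alpha <= _ + _)%N = false); last by case: (r != 0%N); lia.
  by rewrite (_ : (alpha <= _)%N = false) ?andbF ?addr0 ?mul0r//; lia.
- have al : (alpha <= nz l)%N by lia.
  by rewrite (leq_trans al (leq_addr _ _)) al (minn_idPl al) ltnNge al/= !andbF !addn0 addr0 !mul1r.
- rewrite andbT h (_ : (alpha <= alpha.-1)%N = false); last by lia.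
  rewrite add0r; case: (r != 0%N) => /=; last first.
    by rewrite addn0 (_ : (alpha <= alpha.-1)%N = false) ?mul0r//; lia.
  rewrite (_ : (alpha <= alpha.-1 + 1)%N); last by lia.
  rewrite (_ : (alpha.-1 < alpha)%N); last by lia.
  by rewrite (_ : (minn alpha alpha.-1 + _)%N = alpha) ?mul1r//; lia.
Qed.

Lemma sum_nnz_ge_le N :
  \sum_(0 <= l < b ^ N) (alpha <= nz l)%N%:R * wt l <= (B - 1) * tailsum.
Proof.
elim: N => [|N IH].
  rewrite expn0 big_nat1 /nnz /nzpos /= leqNgt (ltnW alpha_gt1) mul0r.
  by rewrite mulr_ge0 ?tailsum_ge0 ?subr_ge0 ?ltW.
rewrite expnS sum_nat_block.
have -> : \sum_(0 <= l < b ^ N) \sum_(0 <= r < b)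
      (alpha <= nz (b * l + r))%N%:R * wt (b * l + r)%N =
    B * x ^+ alpha * \sum_(0 <= l < b ^ N) (alpha <= nz l)%N%:R * wt l +
    (B - 1) * x ^+ alpha * \sum_(0 <= l < b ^ N) (nz l == alpha.-1)%:R * wt l.
  rewrite !mulr_sumr -big_split/=; apply: eq_bigr => l _.
  have -> : \sum_(0 <= r < b) (alpha <= nz (b * l + r))%N%:R * wt (b * l + r)%N =
     \sum_(0 <= r < b) (((alpha <= nz l)%N%:R + ((r != 0%N) && (nz l == alpha.-1))%:R)
       * wt l * x ^+ alpha).
    by rewrite big_nat [RHS]big_nat; apply: eq_bigr => r /andP[_ rb]; exact: tail_block.
  rewrite sum_digit0 /= addr0.
  under eq_big_nat => r /andP[r0 _] do rewrite (_ : (r != 0%N)) ?lt0n_neq0//=.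
  rewrite sumr_const_nat -[X in _ + X = _]mulr_natr natrB ?(ltnW b_gt1)// -/B; ring.
rewrite -[leRHS]tailsum_fix; apply: lerD;
  rewrite ler_wpM2l ?IH ?mulr_ge0 ?subr_ge0 ?(ltW (X _)) ?(ltW B_gt1)//.
by apply: sum_nnz_eq_le; rewrite prednK// ltnW.
Qed.

(** This is what membership in E saves: given the other digits, at most one lowest digit fits the
    congruence. *)
Lemma sum_residue_le1 a : \sum_(0 <= r < b) ((a + r) %% b == 0)%N%:R <= 1 :> R.
Proof.
rewrite big_mkord; have [/existsP[r0 er0]|/existsPn no] :=
  boolP [exists r : 'I_b, ((a + r) %% b == 0)%N].
  rewrite (bigD1 r0)//= er0 big1 ?addr0// => r rr0.
  case: eqP => // /eqP er; case/eqP: rr0; apply: val_inj; apply/eqP => /=.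
  rewrite -(modn_small (ltn_ord r)) -(modn_small (ltn_ord r0)).
  by rewrite -(eqn_modDl a) (eqP er) (eqP er0).
by rewrite big1 ?ler01// => r _; rewrite (negbTE (no r)).
Qed.

(** A lowest digit 0 preserves the digit sum and is covered by induction; of the [b - 1] nonzero
    ones at most one fits. The resulting recursion is [sigma_fix] divided by [b - 1]. *)
Lemma sum_nnz_eq_res_le N v : (0 < v < alpha)%N ->
  \sum_(0 <= l < b ^ N) ((nz l == v) && (digitsum b l %% b == 0)%N)%:R * wt l
    <= sigma v / (B - 1).
Proof.
move=> /andP[v0 va]; have B1 : 0 < B - 1 by rewrite subr_gt0.
elim: N => [|N IH].
  rewrite expn0 big_nat1 /nnz /nzpos /= ltn_eqF// mul0r.
  by rewrite divr_ge0// ltW// sigma_gt0.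
rewrite expnS sum_nat_block.
apply: (@le_trans _ _ (x ^+ v * (\sum_(0 <= l < b ^ N)
     ((nz l == v) && (digitsum b l %% b == 0)%N)%:R * wt l) +
   x ^+ v * \sum_(0 <= l < b ^ N) (nz l == v.-1)%:R * wt l)); last first.
  case: v v0 va IH => // v _ va IH.
  have -> : sigma v.+1 / (B - 1) =
      x ^+ v.+1 * (sigma v.+1 / (B - 1)) + x ^+ v.+1 * sigma v.
    by rewrite -{1}sigma_fix; field; rewrite gt_eqF.
  apply: lerD; rewrite ler_wpM2l ?(ltW (X _))//.
  exact/sum_nnz_eq_le/ltnW.
rewrite !mulr_sumr -big_split/=; apply: ler_sum => l _.
rewrite sum_digit0 wt_block ?(ltnW b_gt1)// nnz_block ?(ltnW b_gt1)//=.
rewrite digitsum_block ?(ltnW b_gt1)// !addn0; apply: lerD.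
  case: eqP => [->|_] /=; last by rewrite !mul0r mulr0.
  by rewrite (minn_idPr (ltnW va)) [leRHS]mulrC mulrA.
apply: (@le_trans _ _ (\sum_(1 <= r < b)
    ((digitsum b l + r) %% b == 0)%N%:R * (x ^+ v * ((nz l == v.-1)%:R * wt l)))).
  rewrite big_nat [leRHS]big_nat; apply: ler_sum => r /andP[r0 rb].
  rewrite wt_block// nnz_block// digitsum_block// (_ : (r != 0%N)) ?lt0n_neq0//= addn1.
  rewrite -(prednK v0) eqSS/= in va *; case: eqP => [e|_] /=; last by rewrite !(mul0r, mulr0).
  rewrite e (minn_idPr (ltnW (ltnW va))) (ltnW va) addn1 mul1r.
  by rewrite [_ * wt l]mulrC.
rewrite -mulr_suml ler_piMl ?mulr_ge0 ?(ltW (X _))//.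
apply: le_trans (sum_residue_le1 (digitsum b l)).
by rewrite [leRHS]sum_digit0 lerDr.
Qed.

(** The congruence constrains the lowest digit only: the higher digits [l] are summed freely with
    the bounds already found, and [tailsum_res] closes the estimate. *)
Lemma sum_nnz_ge_res_le N :
  \sum_(0 <= l < b ^ N) ((alpha <= nz l)%N && (digitsum b l %% b == 0)%N)%:R * wt l
    <= tailsum.
Proof.
case: N => [|N].
  rewrite expn0 big_nat1 /nnz /nzpos /= leqNgt (ltnW alpha_gt1) mul0r.
  exact: tailsum_ge0.
apply: le_trans tailsum_res; rewrite expnS sum_nat_block.
apply: (@le_trans _ _ (x ^+ alpha * (\sum_(0 <= l < b ^ N) (alpha <= nz l)%N%:R * wt l +
   \sum_(0 <= l < b ^ N) (nz l == alpha.-1)%:R * wt l))); last first.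
  rewrite ler_wpM2l ?(ltW (X _))// lerD ?sum_nnz_ge_le//.
  by apply: sum_nnz_eq_le; rewrite prednK// ltnW.
rewrite -big_split/= mulr_sumr; apply: ler_sum => l _.
apply: (@le_trans _ _ (\sum_(0 <= r < b)
    ((digitsum b l + r) %% b == 0)%N%:R *
    (x ^+ alpha * ((alpha <= nz l)%N%:R * wt l + (nz l == alpha.-1)%:R * wt l)))).
  rewrite big_nat [leRHS]big_nat; apply: ler_sum => r /andP[_ rb].
  rewrite digitsum_block// andbC; case: eqP => _ /=; last by rewrite !mul0r.
  rewrite tail_block// mul1r -mulrDl mulrC ler_wpM2l ?(ltW (X _))//.
  by rewrite ler_wpM2r// lerD2l ler_nat; case: (r != 0%N) => //; case: eqP.
by rewrite -mulr_suml ler_piMl ?sum_residue_le1 ?mulr_ge0 ?addr_ge0 ?mulr_ge0 ?(ltW (X _)).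
Qed.

Let nnz_split c l : (c <= nz l)%N ->
  wt l = \sum_(c <= v < alpha) (nz l == v)%:R * wt l + (alpha <= nz l)%N%:R * wt l.
Proof.
move=> cl; rewrite -mulr_suml -mulrDl -[LHS]mul1r; congr (_ * _).
under eq_bigr do rewrite eq_sym mulrb.
rewrite -big_mkcond big_nat1_eq cl /= [(alpha <= _)%N]leqNgt.
by case: (_ < _)%N; rewrite ?addr0 ?add0r.
Qed.

Lemma sum_wt_le N : \sum_(0 <= l < b ^ N) (0 < l)%N%:R * wt l <=
  \sum_(1 <= v < alpha) sigma v + (B - 1) * tailsum.
Proof.
apply: (@le_trans _ _ (\sum_(0 <= l < b ^ N)
    (\sum_(1 <= v < alpha) (nz l == v)%:R * wt l + (alpha <= nz l)%N%:R * wt l))).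
  apply: ler_sum => l _; case: (posnP l) => [_|l0].
    by rewrite mul0r addr_ge0 ?mulr_ge0// sumr_ge0// => v _; rewrite mulr_ge0.
  by rewrite mul1r {1}(nnz_split 1)// nnz_gt0.
rewrite big_split/= lerD ?sum_nnz_ge_le// exchange_big/= big_nat [leRHS]big_nat.
by apply: ler_sum => v /andP[_ va]; exact: sum_nnz_eq_le.
Qed.

(** The sum over [v] starts at 2 because members of E have at least two nonzero digits. *)
Lemma sum_inE_wt_le N : \sum_(0 <= l < b ^ N) (Defs.inE b l)%:R * wt l <=
  \sum_(2 <= v < alpha) sigma v / (B - 1) + tailsum.
Proof.
pose ds0 l := (digitsum b l %% b == 0)%N.
apply: (@le_trans _ _ (\sum_(0 <= l < b ^ N)
    (\sum_(2 <= v < alpha) ((nz l == v) && ds0 l)%:R * wt l +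
     ((alpha <= nz l)%N && ds0 l)%:R * wt l))).
  apply: ler_sum => l _; case: (boolP (Defs.inE b l)) => [lE|_]; last first.
    by rewrite mul0r addr_ge0 ?mulr_ge0// sumr_ge0// => v _; rewrite mulr_ge0.
  rewrite mul1r {1}(nnz_split 2) ?inE_nnz//.
  case/andP: lE => _ ds; rewrite /ds0 ds andbT.
  by under [in leRHS]eq_bigr do rewrite andbT.
rewrite big_split/= lerD ?sum_nnz_ge_res_le// exchange_big/= big_nat [leRHS]big_nat.
apply: ler_sum => v /andP[v2 va]; apply: sum_nnz_eq_res_le.
by rewrite va (ltnW v2).
Qed.

End digit_series.

Lemma esum_nat_le (R : realType) (a : nat -> R) (M : R) :
  (forall k, 0 <= a k) -> (forall N, \sum_(0 <= k < N) a k <= M) ->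
  (\esum_(k in [set: nat]) (a k)%:E <= M%:E)%E.
Proof.
move=> a0 aM; rewrite -nneseries_esumT; last by move=> k; rewrite lee_fin.
apply: lime_le; first by apply: is_cvg_nneseries => k _ _; rewrite lee_fin.
by apply: nearW => N; rewrite sumEFin lee_fin.
Qed.

Lemma sum_nat_widen_le (R : realType) (a : nat -> R) N M : (N <= M)%N ->
  (forall k, 0 <= a k) -> \sum_(0 <= k < N) a k <= \sum_(0 <= k < M) a k.
Proof.
move=> NM a0; rewrite [leRHS](@big_cat_nat _ _ _ N)//= lerDl.
by apply: sumr_ge0.
Qed.

(** * The constants A_1 and A_2 as bounds for sums over E *)

Section walsh_sums.
Context {R : realType}.
Variables (b alpha : nat) (lam : R).
Hypotheses (b_gt1 : (1 < b)%N) (alpha_gt1 : (1 < alpha)%N).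
Hypotheses (lam_gt : 1 / alpha%:R < lam).

Let B : R := b%:R.
Let x : R := B `^ (- lam).

Let B_gt1 : 1 < B. Proof. by rewrite ltr1n. Qed.

Let lam_gt0 : 0 < lam.
Proof. by apply: le_lt_trans lam_gt; rewrite divr_ge0. Qed.

Let x_gt0 : 0 < x. Proof. by rewrite powR_gt0 ?(lt_trans _ B_gt1). Qed.

Let powB (i : nat) : B `^ (lam * i%:R) = x ^- i.
Proof.
by rewrite powRrM powR_mulrn ?powR_ge0// /x powRN exprVn invrK.
Qed.

Let powB1 : B `^ lam = x^-1.
Proof. by rewrite /x powRN invrK. Qed.

Let powB_gt1 (e : R) : 0 < e -> 1 < B `^ e.
Proof.
move=> e0; rewrite -[ltLHS](_ : 1 `^ e = 1); last by rewrite powR1.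
by rewrite gt0_ltr_powR ?nnegrE ?ler0n.
Qed.

Let x_lt1 : x < 1.
Proof. by rewrite -invf_gt1// -powB1 powB_gt1. Qed.

(** The convergence condition: [lam * alpha > 1] makes [b ^ (lam * alpha)] exceed [b]. *)
Let bx_lt1 : b%:R * x ^+ alpha < 1.
Proof.
rewrite -ltr_pdivlMr ?exprn_gt0// mul1r -powB -/B.
have e0 : 0 < lam * alpha%:R - 1.
  by rewrite subr_gt0 -ltr_pdivrMr// ltr0n ltnW.
have B0 : 0 < B by apply: lt_trans B_gt1.
rewrite -[lam * _](subrKC 1) powRD; last by rewrite (gt_eqF B0) implybT.
by rewrite powRr1 ?(ltW B0)// ltr_pMr ?powB_gt1.
Qed.

(** For [k = b * l + r] in E the exponent depends on [l > 0] only, and each [l] admits at most one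
    [r], so [sum_wt_le] applies. [Aab1] is that bound times [b / (b - 1)], a factor at least 1. *)
Lemma esum_inE_le :
  (\esum_(k in [set: nat]) ((Defs.inE b k)%:R * x ^+ mu alpha b (k %/ b))%:E
    <= (Aab1 alpha b lam)%:E)%E.
Proof.
have F0 k : 0 <= (Defs.inE b k)%:R * x ^+ mu alpha b (k %/ b).
  by rewrite mulr_ge0// exprn_ge0// ltW.
apply: esum_nat_le => // N.
apply: (@le_trans _ _ (\sum_(1 <= v < alpha) sigma b x v +
    (B - 1) * tailsum b alpha x)); last first.
  rewrite /Aab1 -/B powB.
  have -> : (x ^- alpha - 1) / (x ^- alpha - B) *
      \prod_(1 <= i < alpha.+1) ((B - 1) / (B `^ (lam * i%:R) - 1)) =
    (B - 1) * tailsum b alpha x.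
    under eq_bigr do rewrite powB.
    rewrite -/(sigma b x alpha) -{3}(prednK (ltnW alpha_gt1)) sigmaS.
    rewrite /tailsum (prednK (ltnW alpha_gt1)) -/B.
    have y1 : x ^+ alpha < 1 by rewrite exprn_ilt1 ?(ltW x_gt0)// -lt0n ltnW.
    have := bx_lt1; rewrite -/B; move: (sigma _ _ _) (x ^+ alpha) (exprn_gt0 alpha x_gt0) y1.
    by move=> s y y0 y1 By; field; do ?[apply/andP; split]; lra.
  under [X in _ <= _ * (X + _)]eq_bigr => v _ do
    (under eq_bigr do rewrite powB; rewrite -/(sigma b x v)).
  set S := (X in X <= _); have S0 : 0 <= S.
    apply: addr_ge0; last by rewrite mulr_ge0 ?tailsum_ge0 ?subr_ge0 ?ltW.
    by apply: sumr_ge0 => v _; rewrite ltW ?sigma_gt0.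
  by rewrite ler_peMl// ler_pdivlMr ?subr_gt0// mul1r gerBl.
have Nb : (N <= b * b ^ N)%N by rewrite -expnS ltnW// ltnW// ltn_expl.
apply: le_trans (sum_nat_widen_le _ _ _ _ Nb F0) _.
apply: le_trans (sum_wt_le b alpha x b_gt1 alpha_gt1 x_gt0 x_lt1 bx_lt1 N).
rewrite sum_nat_block; apply: ler_sum => l _.
have -> : \sum_(0 <= r < b) (Defs.inE b (b * l + r))%:R *
      x ^+ mu alpha b ((b * l + r) %/ b) =
    ((0 < l)%N%:R * x ^+ mu alpha b l) *
      \sum_(0 <= r < b) ((digitsum b l + r) %% b == 0)%N%:R.
  rewrite mulr_sumr big_nat [RHS]big_nat; apply: eq_bigr => r /andP[_ rb].
  rewrite inE_block// mulnC divnMDl ?(ltnW b_gt1)// (divn_small rb) addn0.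
  by rewrite -mulnb natrM; ring.
by rewrite ler_piMr ?sum_residue_le1 ?mulr_ge0 ?exprn_ge0 ?(ltW x_gt0).
Qed.

(** Such a [k] is [b ^ n * l] with [l] in E. Since [l] has at least two nonzero digits and
    [alpha >= 2], the [n - 1] zeros left after division by [b] add at least [2 * (n - 1)] to
    [mu]. *)
Lemma esum_inE_dvd_le n : (0 < n)%N ->
  (\esum_(k in [set: nat])
    ((Defs.inE b k && (b ^ n %| k)%N)%:R * x ^+ mu alpha b (k %/ b))%:E
    <= (x ^+ (2 * n) * Aab2 alpha b lam)%:E)%E.
Proof.
move=> n0; have F0 k : 0 <= (Defs.inE b k && (b ^ n %| k)%N)%:R * x ^+ mu alpha b (k %/ b).
  by rewrite mulr_ge0// exprn_ge0// ltW.
apply: esum_nat_le => // N.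
have bn0 : (0 < b ^ n)%N by rewrite expn_gt0 (ltnW b_gt1).
have Nb : (N <= b ^ n * b ^ N)%N.
  by rewrite (leq_trans (ltnW (ltn_expl N b_gt1)))// leq_pmull.
apply: le_trans (sum_nat_widen_le _ _ _ _ Nb F0) _.
rewrite sum_nat_block.
apply: (@le_trans _ _ (x ^+ (2 * n.-1) *
    (\sum_(2 <= v < alpha) sigma b x v / (B - 1) + tailsum b alpha x))).
  apply: le_trans (ler_wpM2l _ (sum_inE_wt_le b alpha x b_gt1 alpha_gt1 x_gt0 x_lt1 bx_lt1 N));
    last by rewrite exprn_ge0// ltW.
  rewrite mulr_sumr; apply: ler_sum => l _.
  rewrite big_ltn// addn0 big_nat big1 ?addr0; last first.
    move=> r /andP[r0 rb]; rewrite dvdn_addr ?dvdn_mulr//.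
    by rewrite (gtnNdvd r0 rb) andbF mul0r.
  rewrite dvdn_mulr// andbT inE_shift//.
  case: (boolP (Defs.inE b l)) => [lE|_]; last by rewrite !(mul0r, mulr0).
  rewrite -{1}(prednK n0) expnS -mulnA mulKn ?(ltnW b_gt1)// mu_shift// !mul1r exprD mulrC.
  rewrite ler_wpM2r ?exprn_ge0 ?(ltW x_gt0)// ler_wiXn2l ?(ltW x_gt0) ?(ltW x_lt1)//.
  by rewrite mulnC leq_mul2l leq_min alpha_gt1 (inE_nnz b b_gt1) ?orbT.
have -> : x ^+ (2 * n) = x ^+ (2 * n.-1) * x ^+ 2.
  by rewrite -exprD; congr (_ ^+ _); lia.
rewrite -mulrA ler_wpM2l ?exprn_ge0 ?(ltW x_gt0)//.
have prodE v : \prod_(1 <= i < v.+1) (B `^ lam * (B - 1) / (B `^ (lam * i%:R) - 1)) =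
    x ^- v * sigma b x v.
  under eq_bigr do rewrite powB powB1 -mulrA.
  by rewrite big_split/= prodr_const_nat subn1 exprVn.
(* The missing factor [x ^ 2] is outweighed by the powers of [b ^ lam = x^-1] in [Aab2], of which
   every term has at least two. *)
have x2 v : (2 <= v)%N -> 1 <= x ^+ 2 * x ^- v.
  move=> v2; rewrite ler_pdivlMr ?exprn_gt0// mul1r.
  by rewrite ler_wiXn2l ?(ltW x_gt0) ?(ltW x_lt1).
rewrite /Aab2 -/B powB mulrDr; apply: lerD.
  rewrite mulr_sumr mulr_sumr big_nat [leRHS]big_nat; apply: ler_sum => v /andP[v2 _].
  rewrite prodE (_ : _ * (_ * (_ * _)) = (x ^+ 2 * x ^- v) * (sigma b x v / (B - 1))).
    by rewrite ler_peMl ?x2// divr_ge0 ?subr_ge0 ?(ltW B_gt1)// ltW ?sigma_gt0.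
  by rewrite div1r; ring.
have := prodE alpha.-1; rewrite (prednK (ltnW alpha_gt1)) => ->.
have xa : x ^- alpha = x^-1 * x ^- alpha.-1.
  by rewrite -invfM -exprS (prednK (ltnW alpha_gt1)).
have -> : x ^+ 2 * (B `^ lam / (x ^- alpha - B) * (x ^- alpha.-1 * sigma b x alpha.-1)) =
   x ^+ 2 * x ^- alpha * tailsum b alpha x.
  by rewrite powB1 /tailsum xa -/B; ring.
by rewrite ler_peMl ?x2// tailsum_ge0.
Qed.

End walsh_sums.

(** A digit is below the prime [b], hence zero as soon as its image in ['F_b] is. *)
Lemma trn_eq0_dvdn (b n k : nat) : prime b -> trn b n k = 0 -> (b ^ n %| k)%N.
Proof.
move=> b_pr tr0; have {tr0} dig i : (i < n)%N -> digit b k i = 0%N.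
  move=> ltin; have := congr1 (fun r : {poly 'F_b} => r`_i) tr0.
  rewrite coef_poly ltin coef0 => /(congr1 (fun y : 'F_b => (y : nat))).
  by rewrite val_Fp_nat// /digit modn_mod.
elim: n dig => [|n IH] dig; first by rewrite expn0 dvd1n.
have /dvdnP[l kE] : (b ^ n %| k)%N by apply: IH => i ltin; exact/dig/ltnW.
have := dig n (ltnSn n); rewrite kE /digit mulnK ?expn_gt0 ?prime_gt0// => /eqP bl.
by rewrite expnS dvdn_mul.
Qed.

Lemma exists_le_mean (R : realType) (T : finType) (f : T -> \bar R) (C : R) :
  (0 < #|T|)%N -> (\sum_v f v <= (#|T|%:R * C)%:E)%E -> exists v, (f v <= C%:E)%E.
Proof.
move=> T0 fC; apply: contrapT => no.
have /card_gt0P[v0 _] := T0.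
have [v _ vmin] := arg_minP f (isT : xpredT v0).
have Cv : (C%:E < f v)%E by rewrite ltNge; apply/negP => le; apply: no; exists v.
(* The minimum may be infinite, so a real [r] above [C] and at most [f v] takes its place. *)
have [r Cr rv] : exists2 r, C < r & (r%:E <= f v)%E.
  case: (f v) Cv => [r| |]//; first by exists r.
  by exists (C + 1); rewrite ?ltrDl ?leey.
have : (\sum_(u : T) r%:E <= (#|T|%:R * C)%:E)%E.
  by apply: le_trans fC; apply: lee_sum => u _; apply: le_trans rv _; exact: vmin.
rewrite sumEFin lee_fin sumr_const -[leLHS]mulr_natl ler_pM2l ?ltr0n//.
by rewrite leNgt Cr.
Qed.

Lemma esum_delta0 (R : realType) :
  (\esum_(k in [set: nat]) (((k == 0%N)%:R : R)%:E) = 1)%E.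
Proof.
rewrite -[RHS](@esum_set1 R _ 0%N (fun=> 1%E))// [RHS]esum_mkcond; apply: eq_esum => k _.
by rewrite classical_sets.in_set1; case: (k == 0%N).
Qed.

(** A finite bound on the [l]-th power rules out infinity, so extended sums can be exchanged for
    real numbers. *)
Lemma poweR_le_fin (R : realType) (y : \bar R) (l r : R) : 0 < l ->
  (0 <= y)%E -> (y `^ l <= r%:E)%E -> exists s, [/\ y = s%:E, 0 <= s & s `^ l <= r].
Proof.
move=> l0; case: y => [s| |]//; last by rewrite poweRyr ?gt_eqF.
by rewrite lee_fin poweR_EFin lee_fin => s0 sr; exists s.
Qed.

(** * One step of the component-by-component construction *)

Section cbc_step.
Context {R : realType}.
Variables (b n m alpha : nat) (lam : R) (p : {poly 'F_b}) (g : nat -> R).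
Hypotheses (b_pr : prime b) (n_gt0 : (0 < n)%N) (mn : (m <= n)%N).
Hypotheses (alpha_gt1 : (1 < alpha)%N) (lam_gt : 1 / alpha%:R < lam) (lam_le1 : lam <= 1).
Hypotheses (irr_p : irreducible_poly p) (size_p : size p = n.+1).
Hypothesis g_ge0 : forall j, 0 <= g j.

Let B : R := b%:R.
Let x : R := B `^ (- lam).
Let b_gt1 : (1 < b)%N. Proof. exact: prime_gt1. Qed.
Let lam_gt0 : 0 < lam.
Proof. by apply: le_lt_trans lam_gt; rewrite divr_ge0. Qed.
Let lam01 : 0 < lam <= 1. Proof. by rewrite lam_gt0. Qed.
Let A1 : R := Aab1 alpha b lam.
Let A2 : R := Aab2 alpha b lam.
Let w := cweight alpha b g.
Let wl j k := w j k `^ lam.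
Let tr := trn b n.
Let c j := g j `^ lam.

Let w_ge0 j k : 0 <= w j k. Proof. exact: cweight_ge0. Qed.
Let wl_ge0 j k : 0 <= wl j k. Proof. exact: powR_ge0. Qed.
Let c_ge0 j : 0 <= c j. Proof. exact: powR_ge0. Qed.
Let x_gt0 : 0 < x. Proof. by rewrite powR_gt0// ltr0n ltnW. Qed.

Lemma Aab1_ge0 : 0 <= A1.
Proof.
rewrite -lee_fin; apply: le_trans (esum_inE_le b alpha lam b_gt1 alpha_gt1 lam_gt).
by apply: esum_ge0 => k _; rewrite lee_fin mulr_ge0// exprn_ge0// ltW.
Qed.

Lemma Aab2_ge0 : 0 <= A2.
Proof.
rewrite -(pmulr_rge0 _ (exprn_gt0 (2 * n) x_gt0)) -lee_fin.
apply: le_trans (esum_inE_dvd_le b alpha lam b_gt1 alpha_gt1 lam_gt _ n_gt0).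
by apply: esum_ge0 => k _; rewrite lee_fin mulr_ge0// exprn_ge0// ltW.
Qed.

Let powR_term j k : (g j * B ^- k) `^ lam = c j * x ^+ k.
Proof.
rewrite powRM ?invr_ge0 ?exprn_ge0 ?ler0n//; congr (_ * _).
by rewrite -powR_invn ?ler0n// -powRrM -[RHS]powR_mulrn ?powR_ge0// -powRrM; congr (_ `^ _); ring.
Qed.

Lemma powR_cweight j k : wl j k =
  (k == 0%N)%:R + c j * ((Defs.inE b k)%:R * x ^+ mu alpha b (k %/ b)).
Proof.
rewrite /wl /w /cweight; case: eqP => [->|_]; first by rewrite powR1 /= mul0r mulr0 addr0.
rewrite add0r; case: ifP => _; last by rewrite powR0 ?gt_eqF// mul0r mulr0.
by rewrite powR_term mul1r.
Qed.

(** [1 + c j * A1] already bounds the sum; [A2 >= 0] is added so that the factor agrees with the one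
    in the final product. *)
Lemma esum_powR_cweight_le j :
  (\esum_(k in setT) (wl j k)%:E <= (1 + c j * (A1 + A2))%:E)%E.
Proof.
under eq_esum => k _ do rewrite powR_cweight EFinD EFinM.
rewrite esumD => [||k _]; last 2 first.
- by move=> k _; rewrite lee_fin.
- by rewrite mule_ge0 ?lee_fin// mulr_ge0// exprn_ge0// ltW.
rewrite [leRHS]EFinD; apply: leeD.
  by rewrite esum_delta0.
rewrite esumZl//; last first.
  by move=> k _; rewrite lee_fin mulr_ge0// exprn_ge0// ltW.
rewrite [leRHS]EFinM; apply: lee_wpmul2l; first by rewrite lee_fin.
apply: le_trans (esum_inE_le b alpha lam b_gt1 alpha_gt1 lam_gt) _.
by rewrite lee_fin lerDl Aab2_ge0.
Qed.

(** The witness [s] is the weight of the nonzero [k] with [tr k = 0], and [th] is what the [k] with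
    [tr k != 0] contribute. *)
Lemma cbc_candidate (q : nat -> {poly 'F_b}) t (beta : R) : 0 <= beta ->
  dualsum (n - m) p tr w q t 0 = (1 + beta)%:E ->
  exists2 q' : {poly 'F_b}, (size q' <= n)%N & exists s th : R,
   [/\ 0 <= s, 0 <= th, s `^ lam <= c t * (x ^+ (2 * n) * A2),
       th `^ lam <= B ^- m * (c t * A1) * \prod_(j < t) (1 + c j * (A1 + A2))
     & (\esum_(k in setT) ((w t k)%:E * dualsum (n - m) p tr w q t (tr k * q'))
          <= ((1 + beta) * (1 + s) + th)%:E)%E].
Proof.
move=> beta0 G0; pose K := [set k | tr k = 0].
pose P := \prod_(j < t) (1 + c j * (A1 + A2)).
have P0 : 0 <= P.
  by apply: prodr_ge0 => j _; rewrite addr_ge0// mulr_ge0// addr_ge0 ?Aab1_ge0 ?Aab2_ge0.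
have tr0 : tr 0%N = 0.
  by apply/polyP => i; rewrite coef_poly coef0 /digit div0n mod0n; case: ifP.
have pK k : ~ K k -> ~~ (p %| tr k).
  move=> trk; apply/negP => /dvdp_leq; rewrite size_p ltnNge size_poly.
  by move/(_ (introN eqP trk)).
pose th q' := (\esum_(k in ~` K) ((wl t k)%:E * dualsum (n - m) p tr wl q t (tr k * q')))%E.
(* The index 0 lies in [K], so its weight 1 does not occur here. *)
have sumNK : (\esum_(k in ~` K) (wl t k)%:E <= (c t * A1)%:E)%E.
  rewrite EFinM; apply: le_trans (lee_wpmul2l _ (esum_inE_le b alpha lam b_gt1 alpha_gt1 lam_gt));
    last by rewrite lee_fin.
  rewrite -esumZl//.
  rewrite esum_mkcond; apply: le_esum => k _; case: ifPn => [/set_mem trk|_]; last first.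
    by rewrite mule_ge0 ?lee_fin// mulr_ge0// exprn_ge0// ltW.
  rewrite powR_cweight; case: eqP => [k0|_]; first by rewrite k0 in trk.
  by rewrite add0r EFinM.
(* For fixed [k] outside [K], multiplication by [tr k] permutes the residues, so the inner sums over
   all candidates total at most [b ^ (n - m) * P]; against [b ^ n] candidates this is the gain
   [b ^- m]. *)
have avg : (\sum_(v : 'rV['F_b]_n) th (rVpoly v) <=
    (#|{: 'rV['F_b]_n}|%:R * (B ^- m * (c t * A1) * P))%:E)%E.
  rewrite /th -esum_sum => [|k v _ _]; last by rewrite mule_ge0 ?lee_fin ?dualsum_ge0.
  pose C := (b ^ (n - m))%:R * P; have C0 : 0 <= C by rewrite mulr_ge0.
  have -> : #|{: 'rV['F_b]_n}|%:R * (B ^- m * (c t * A1) * P) = C * (c t * A1).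
    rewrite card_mx mul1n card_Fp// /C !natrX -/B -[in LHS](subnK mn) exprD.
    by field; rewrite expf_neq0// pnatr_eq0 -lt0n ltnW.
  rewrite EFinM; apply: le_trans (lee_wpmul2l _ sumNK); last by rewrite lee_fin.
  rewrite -esumZl//; last by move=> k _; rewrite lee_fin.
  apply: le_esum => k trk; rewrite -ge0_sume_distrr; last by move=> v _; exact: dualsum_ge0.
  rewrite muleC; apply: lee_wpmul2r; first by rewrite lee_fin.
  rewrite (sum_residues_mul _ _ irr_p size_p (dualsum (n - m) p tr wl q t))//; last 2 first.
  - by move=> c'; exact: dualsum_modp.
  - exact: pK.
  have := sum_dualsum_le n (n - m) p tr irr_p size_p wl q t
    (fun j => 1 + c j * (A1 + A2)) wl_ge0.
  rewrite card_Fp// -/P -/C; apply=> j _; exact: esum_powR_cweight_le.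
have [v thv] : exists v : 'rV['F_b]_n, (th (rVpoly v) <= (B ^- m * (c t * A1) * P)%:E)%E.
  by apply: exists_le_mean avg; apply/card_gt0P; exists 0.
exists (rVpoly v); first exact: size_poly.
pose sE := (\esum_(k in [set: nat])
  ((Defs.inE b k && (b ^ n %| k)%N)%:R * (g t * B ^- mu alpha b (k %/ b)))%:E)%E.
have term0 k : 0 <= (Defs.inE b k && (b ^ n %| k)%N)%:R * (g t * B ^- mu alpha b (k %/ b)).
  by rewrite !mulr_ge0// invr_ge0 exprn_ge0.
have [||s [sEs s0 sl]] := poweR_le_fin _ sE lam (c t * (x ^+ (2 * n) * A2)) lam_gt0.
- by apply: esum_ge0 => k _; rewrite lee_fin.
- apply: le_trans (poweR_esum_le _ _ _ lam01 _) _ => [k _|]; first by rewrite lee_fin.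
  rewrite EFinM; apply: le_trans (lee_wpmul2l _
    (esum_inE_dvd_le b alpha lam b_gt1 alpha_gt1 lam_gt _ n_gt0)); last by rewrite lee_fin.
  rewrite -esumZl//.
  apply: le_esum => k _; rewrite poweR_EFin; case: (_ && _); last first.
    by rewrite !mul0r powR0 ?gt_eqF// mule0.
  by rewrite !mul1r powR_term EFinM.
pose thE := (\esum_(k in ~` K) ((w t k)%:E * dualsum (n - m) p tr w q t (tr k * rVpoly v)))%E.
have thE0 k : (0 <= (w t k)%:E * dualsum (n - m) p tr w q t (tr k * rVpoly v))%E.
  by rewrite mule_ge0 ?lee_fin ?dualsum_ge0.
have [||r [thEr r0 rl]] := poweR_le_fin _ thE lam (B ^- m * (c t * A1) * P) lam_gt0.
- exact: esum_ge0.
- apply: le_trans (poweR_esum_le _ _ _ lam01 _) _ => [k _|]; first exact: thE0.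
  apply: le_trans thv; apply: le_esum => k _.
  rewrite poweRM ?lee_fin ?dualsum_ge0// poweR_EFin.
  by apply: lee_wpmul2l; rewrite ?lee_fin ?powR_ge0//; exact: poweR_dualsum_le.
exists s, r; split=> //.
rewrite (esumID K)// !setTI -/thE thEr EFinD; apply: leeD => //.
(* On [K] the shift [tr k * q'] is 0, so each inner sum is [1 + beta]. *)
under eq_esum => k trk do rewrite trk mul0r G0 muleC.
rewrite esumZl ?addr_ge0//; last by move=> k _; rewrite lee_fin.
rewrite EFinM; apply: lee_wpmul2l; first by rewrite lee_fin addr_ge0.
rewrite EFinD -sEs -[1%:E](esum_delta0 R) -esumD; try by move=> k _; rewrite lee_fin.
rewrite esum_mkcond; apply: le_esum => k _; case: ifPn => [/set_mem trk|_]; last first.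
  by rewrite adde_ge0 ?lee_fin.
(* Here [k] is a multiple of [b ^ n]: it is 0, with weight 1, or its weight is a term of [sE]. *)
rewrite -EFinD lee_fin /w /cweight (trn_eq0_dvdn _ _ _ b_pr trk) andbT.
case: eqP => _; first by rewrite lerDl !mulr_ge0// invr_ge0 exprn_ge0.
by rewrite add0r; case: ifP => _; rewrite ?mul1r ?mul0r.
Qed.

End cbc_step.

(** * Induction over the components *)

Lemma Balpha_ge0 (R : realType) (alpha b n m : nat) (gamma : nat -> R) (D : R)
    (p : {poly 'F_b}) (qs : seq {poly 'F_b}) :
  (0 <= Balpha alpha b n m gamma D p qs)%E.
Proof.
apply: sume_ge0 => u _; apply: mule_ge0.
  by rewrite lee_fin mulr_ge0 ?exprn_ge0 ?sqrtr_ge0.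
by apply: esum_ge0 => k _; rewrite lee_fin invr_ge0 exprn_ge0.
Qed.

(** [Xm] and [X2] are the gains [b^-m] and [b^(-2 lam n)], both dominated by [M]. Subadditivity is
    applied to [beta + s + beta * s + th]; as [M <= 1], the factor [1 + beta^lam] is at most [P]. *)
Lemma cbc_step_bound (R : realType) (beta beta' s th lam M P c A1 A2 X2 Xm : R) :
  0 <= beta -> 0 <= beta' -> 0 <= s -> 0 <= th -> 0 < lam <= 1 ->
  0 <= c -> 0 <= A1 -> 0 <= A2 -> 1 <= P ->
  0 <= M <= 1 -> X2 <= M -> Xm <= M ->
  beta `^ lam <= M * (P - 1) -> s `^ lam <= c * (X2 * A2) ->
  th `^ lam <= Xm * (c * A1) * P ->
  1 + beta' <= (1 + beta) * (1 + s) + th ->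
  beta' `^ lam <= M * (P * (1 + c * (A1 + A2)) - 1).
Proof.
move=> be0 be0' s0 th0 lam01 c0 A10 A20 P1 /andP[M0 M1] X2M XmM beP sP thP le.
have lam0 : 0 <= lam by case/andP: lam01 => /ltW.
have bs0 : 0 <= beta * s by rewrite mulr_ge0.
apply: (@le_trans _ _ (beta `^ lam + (s `^ lam + beta `^ lam * s `^ lam) + th `^ lam)).
  apply: (@le_trans _ _ ((beta + (s + beta * s) + th) `^ lam)).
    by apply: ge0_ler_powR; rewrite ?nnegrE ?addr_ge0//; lra.
  apply: le_trans (powRD_le _ _ _ _ _ _ lam01) _; rewrite ?addr_ge0// lerD2r.
  apply: le_trans (powRD_le _ _ _ _ _ _ lam01) _; rewrite ?addr_ge0// lerD2l.
  by apply: le_trans (powRD_le _ _ _ _ _ _ lam01) _; rewrite // powRM.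
have MP : M * (P - 1) <= P - 1 by rewrite ler_piMl ?subr_ge0.
have sM : s `^ lam * (1 + beta `^ lam) <= c * (M * A2) * P.
  apply: ler_pM; rewrite ?powR_ge0 ?addr_ge0 ?powR_ge0//.
    by apply: le_trans sP _; rewrite ler_wpM2l// ler_wpM2r.
  by apply: (@le_trans _ _ (1 + (P - 1))); [rewrite lerD2l (le_trans beP)|rewrite subrKC].
have thM : th `^ lam <= M * (c * A1) * P.
  by apply: le_trans thP _; rewrite !ler_wpM2r ?mulr_ge0 ?(le_trans ler01 P1).
have -> : M * (P * (1 + c * (A1 + A2)) - 1) =
  M * (P - 1) + c * (M * A2) * P + M * (c * A1) * P by ring.
apply: lerD thM; apply: lerD => //.
by apply: le_trans sM; rewrite mulrDr mulr1 [in leRHS]mulrC.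
Qed.

Theorem theorem5p2 (R : realType) (b s m n alpha : nat)
  (gamma : nat -> R) (D : R) (p : {poly 'F_b}) (q : nat -> {poly 'F_b}) :
  prime b -> (0 < s)%N -> (0 < m)%N -> (2 <= alpha)%N -> (m <= n)%N ->
  (forall j, (j < s)%N -> 0 <= gamma j) ->
  admissibleD alpha b D ->
  irreducible_poly p -> size p = n.+1 ->
  (* component-by-component construction *)
  (forall t, (t < s)%N ->
     (size (q t) <= n)%N /\
     (forall q' : {poly 'F_b}, (size q' <= n)%N ->
        (Balpha alpha b n m gamma D p (rcons (mkseq q t) (q t))
          <= Balpha alpha b n m gamma D p (rcons (mkseq q t) q'))%E)) ->
  forall (t : nat) (lam : R), (1 <= t <= s)%N -> 1 / alpha%:R < lam <= 1 ->
    (Balpha alpha b n m gamma D p (mkseq q t)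
     <= ((b%:R : R) `^ (- Order.min (m%:R / lam) (2 * n)%:R) *
         (-1 + \prod_(j < t)
                 (1 + gamma j `^ (lam / 2) * D `^ (lam / 2) * Aab alpha b lam))
           `^ (1 / lam))%:E)%E.
Proof.
move=> b_pr _ m_gt0 alpha_gt1 mn gamma0 [D0 _] irr_p size_p cbc t lam /andP[_ ts].
move=> /andP[lam_gt lam_le1].
have lam_gt0 : 0 < lam by apply: le_lt_trans lam_gt; rewrite divr_ge0.
have lam01 : 0 < lam <= 1 by rewrite lam_gt0.
have n_gt0 := leq_trans m_gt0 mn.
pose g j := Num.sqrt (gamma j) * Num.sqrt D.
have g0 j : 0 <= g j by rewrite mulr_ge0 ?sqrtr_ge0.
pose c j := g j `^ lam; have c0 j : 0 <= c j by exact: powR_ge0.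
have cE j : (j < s)%N -> gamma j `^ (lam / 2) * D `^ (lam / 2) = c j.
  move=> js; rewrite /c /g powRM ?sqrtr_ge0// -!powR12_sqrt ?gamma0 ?(ltW D0)//.
  by rewrite -!powRrM [2^-1 * lam]mulrC.
pose B : R := b%:R; pose x := B `^ (- lam); pose e := Order.min (m%:R / lam) (2 * n)%:R.
(* [M] is the [lam]-th power of the prefactor, [b^(-min(m, 2 n lam))]. *)
pose M := B `^ (- e) `^ lam; pose A := Aab alpha b lam.
have B1 : 1 <= B by rewrite ler1n prime_gt0.
have M01 : 0 <= M <= 1.
  have e0 : 0 <= e by rewrite le_min divr_ge0 ?ler0n ?(ltW lam_gt0).
  rewrite powR_ge0 /M -powRrM -[leRHS](powRr0 B) ler_powR//.
  by rewrite mulNr oppr_le0 mulr_ge0 ?(ltW lam_gt0).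
have xM : x ^+ (2 * n) <= M.
  rewrite -powR_mulrn ?powR_ge0// /M -!powRrM ler_powR// !mulNr lerN2 mulrC.
  by rewrite ler_wpM2l ?(ltW lam_gt0)// ge_min lexx orbT.
have BmM : B ^- m <= M.
  rewrite -powR_invn ?ler0n// /M -!powRrM ler_powR// !mulNr lerN2.
  by rewrite -ler_pdivlMr// ge_min lexx.
have A1_ge0 : 0 <= Aab1 alpha b lam by exact: Aab1_ge0.
have A2_ge0 : 0 <= Aab2 alpha b lam by exact: (Aab2_ge0 b n).
have A0 : 0 <= A by exact: addr_ge0.
pose P t := \prod_(j < t) (1 + c j * A).
have P1 t' : 1 <= P t'.
  by rewrite /P; elim/big_ind: _ => // [y z y1 z1|j _]; [rewrite mulr_ege1|rewrite lerDl mulr_ge0].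
(* Finiteness of [Balpha] is part of the induction, which runs on [lam]-th powers; the root is taken
   at the end. *)
have main t' : (t' <= s)%N -> exists beta : R,
    [/\ Balpha alpha b n m gamma D p (mkseq q t') = beta%:E, 0 <= beta &
        beta `^ lam <= M * (P t' - 1)].
  elim: t' => [_|t' IH t's].
    exists 0; rewrite /P big_ord0 subrr mulr0 powR0 ?gt_eqF//; split=> //.
    rewrite /Balpha big1// => u; rewrite card_gt0 => /set0Pn[] [].
    by [].
  have [beta [betaE beta0 betaP]] := IH (ltnW t's).
  have GE : dualsum (n - m) p (trn b n) (cweight alpha b g) q t' 0 = (1 + beta)%:E.
    rewrite EFinD -betaE (Balpha_dualsum _ alpha b n m gamma D p (mkseq q t'))//; last first.
      by move=> j; rewrite size_mkseq => jt; apply: gamma0; exact: leq_trans jt (ltnW t's).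
    by rewrite size_mkseq; apply: eq_dualsum => j jt; rewrite nth_mkseq.
  have [q' sq' [s' [th [s0 th0 sP thP leG]]]] := cbc_candidate b n m alpha lam p g b_pr n_gt0
    mn alpha_gt1 lam_gt lam_le1 irr_p size_p g0 q t' beta beta0 GE.
  have := (cbc t' t's).2 q' sq'; rewrite -mkseqS => le1.
  have le2 : (1 + Balpha alpha b n m gamma D p (mkseq q t'.+1) <=
      ((1 + beta) * (1 + s') + th)%:E)%E.
    apply: le_trans leG; apply: le_trans (leeD2l 1%E le1) _.
    rewrite Balpha_dualsum//; last first.
      by move=> j; rewrite size_rcons size_mkseq => jt; apply: gamma0; exact: leq_trans jt t's.
    rewrite size_rcons size_mkseq /=; apply: le_esum => k _.
    rewrite nth_rcons size_mkseq ltnn eqxx add0r.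
    rewrite (eq_dualsum _ _ _ _ _ q)// => j jt.
    by rewrite nth_rcons size_mkseq jt nth_mkseq.
  have := Balpha_ge0 R alpha b n m gamma D p (mkseq q t'.+1).
  case: (Balpha alpha b n m gamma D p (mkseq q t'.+1)) le2 => [beta' | |]//.
  rewrite -EFinD !lee_fin => le2 beta0'; exists beta'; split=> //.
  rewrite {1}/P big_ord_recr/= -/(P t').
  exact: (cbc_step_bound _ beta beta' s' th lam M (P t') (c t')
    (Aab1 alpha b lam) (Aab2 alpha b lam) (x ^+ (2 * n)) (B ^- m)).
have [beta [-> beta0 betaP]] := main t ts.
have -> : \prod_(j < t) (1 + gamma j `^ (lam / 2) * D `^ (lam / 2) * Aab alpha b lam) = P t.
  by apply: eq_bigr => j _; rewrite cE// (leq_trans (ltn_ord j) ts).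
rewrite lee_fin addrC.
have -> : B `^ (- e) * (P t - 1) `^ (1 / lam) = (M * (P t - 1)) `^ (1 / lam).
  rewrite [RHS]powRM ?subr_ge0 ?P1//; last by case/andP: M01.
  by rewrite /M -!powRrM div1r mulfV ?mulr1// gt_eqF.
have -> : beta = beta `^ lam `^ (1 / lam).
  by rewrite -powRrM div1r mulfV ?powRr1// gt_eqF.
apply: ge0_ler_powR; rewrite ?nnegrE ?powR_ge0 ?divr_ge0 ?(ltW lam_gt0)//.
by rewrite (le_trans _ betaP)// powR_ge0.
Qed.
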